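(* There exists a primitive sequence $\mathscr{A} \neq \{1\}$ of positive integers such that $$ \sum_{a \in \mathscr{A}} \frac{\omega(a)}{a \log a} \;>\; \sum_{p \in \mathscr{P}} \frac{\omega(p)}{p \log p} \;=\; \sum_{p \in \mathscr{P}} \frac{1}{p \log p}, $$ where $\mathscr{P}$ denotes the sequence of all prime numbers and $\omega(n)$ denotes the number of distinct prime factors of the positive integer $n$.
   Context: A sequence (regarded as a set of distinct elements, finite or infinite) $\mathscr{A}$ of positive integers is called primitive if no term of $\mathscr{A}$ divides any other term of $\mathscr{A}$. $\mathscr{P}$ is the sequence of the prime numbers. For a positive integer $n$, $\omega(n)$ is the number of prime factors of $n$ counted without multiplicity. $\log$ is the natural logarithm. All sums have non-negative terms. *)

(* Defs.v *)
From mathcomp Require Import all_boot all_order all_algebra.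
From mathcomp Require Import all_classical all_reals all_analysis.

Set Implicit Arguments.
Unset Strict Implicit.
Unset Printing Implicit Defensive.

Import Order.TTheory GRing.Theory Num.Theory.

Local Open Scope classical_set_scope.
Local Open Scope ring_scope.

Definition positive_terms (A : set nat) : Prop := forall a, A a -> (0 < a)%N.

Definition primitive_seq (A : set nat) : Prop :=
  forall a b, A a -> A b -> a <> b -> ~~ (a %| b)%N.

Definition omega (n : nat) : nat := size (primes n).

Definition prime_set : set nat := [set p | prime p].

(* The value is +oo when the series diverges. [esum] is the intended sum
   because all terms are non-negative, including the term at a = 1, which is
   0 / 0 = 0. *)
Definition omega_sum (R : realType) (A : set nat) : \bar R :=
  \esum_(a in A) ((omega a)%:R / (a%:R * ln (a%:R : R)))%:E.

(* Main.v *)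
Require Import Defs.
From mathcomp Require Import all_boot all_order all_algebra.
From mathcomp Require Import all_classical all_reals all_analysis.
From mathcomp Require Import ring lra zify.

(* Among the squarefree integers with exactly k prime factors, which form a
   primitive set, the sum of omega(n) / (n log n) tends to infinity with k, while
   the sum of 1 / (p log p) over the primes is finite by Chebyshev's bound.

   Let W(x) = prod_(r <= x) (1 + 1/r)^-1 over primes r and let P(n) be the largest
   prime factor of n. Since the sum of W(q)/q over the primes q > p telescopes to
   W(p), the weights W(P(n))/n define a probability measure on the k-th level, and
   passing from level k to level k+1 is a Markov chain n -> n q, where q > P(n) has
   conditional probability W(q)/q / W(P(n)). By Chebyshev W(p^2) >= exp(-6) W(p),
   so the mean of log P(n) / log q is bounded by some u < 1; hence the mean of
   X(n) = log n / log P(n) is at most 1/(1-u) on every level. As W(x) log x <= 2,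
   the sum of k / (n log n) is at least k/2 times the mean of 1/X, thus at least a
   multiple of k by convexity. Truncating q at a large N at every step keeps the
   levels finite and at least half of the mass. *)

Set Implicit Arguments.
Unset Strict Implicit.
Import Order.TTheory GRing.Theory Num.Theory.
Local Open Scope classical_set_scope.
Local Open Scope ring_scope.

(** * The product over primes and its telescoping sum *)

Lemma big_nat_recr_cond (T : Type) (idx : T) (op : Monoid.law idx) (m n : nat)
    (P : pred nat) (F : nat -> T) : (m <= n)%N ->
  \big[op/idx]_(m <= i < n.+1 | P i) F i =
  op (\big[op/idx]_(m <= i < n | P i) F i) (if P n then F n else idx).
Proof. by move=> mn; rewrite big_mkcond big_nat_recr //= -big_mkcond. Qed.

Definition euler_weight (R : realType) (x : nat) : R :=
  \prod_(0 <= r < x.+1 | prime r) (1 + r%:R^-1)^-1.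

Lemma euler_weight_gt0 (R : realType) (x : nat) : 0 < euler_weight R x.
Proof. by apply: prodr_gt0 => r _; rewrite invr_gt0 ltr_wpDr. Qed.

Lemma euler_weight1 (R : realType) : euler_weight R 1 = 1.
Proof. by rewrite /euler_weight big_mkcond /= !big_nat_recr //= big_nil !mulr1. Qed.

Lemma euler_weightS (R : realType) (x : nat) :
  euler_weight R x.+1 =
  euler_weight R x * (if prime x.+1 then (1 + x.+1%:R^-1)^-1 else 1).
Proof. by rewrite /euler_weight big_nat_recr_cond. Qed.

(** For prime [q], [W(q) (1 + 1/q) = W(q-1)], so each term is the drop [W(q-1) - W(q)]. *)
Lemma sum_euler_weight (R : realType) (p N : nat) : (p <= N)%N ->
  \sum_(p.+1 <= q < N.+1 | prime q) euler_weight R q / q%:R =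
  euler_weight R p - euler_weight R N.
Proof.
elim: N => [|N IH]; first by case: p => // _; rewrite big_geq // subrr.
rewrite leq_eqVlt => /orP[/eqP ->|]; first by rewrite big_geq // subrr.
rewrite ltnS => pN; rewrite big_nat_recr_cond //= IH // euler_weightS.
case: (prime N.+1); last by rewrite mulr1 addr0.
have := ltr0Sn R N; move: (N.+1%:R) => a a0.
by field; rewrite !gt_eqF // ltr_wpDr // ltW.
Qed.

Lemma le_euler_weight (R : realType) (p N : nat) : (p <= N)%N ->
  euler_weight R N <= euler_weight R p.
Proof.
move=> pN; rewrite -subr_ge0 -sum_euler_weight // sumr_ge0 // => q _.
by rewrite divr_ge0 // ltW ?euler_weight_gt0.
Qed.

(** Each factor satisfies [1 + 1/r <= exp(1/r)]. *)
Lemma euler_weight_le_expR (R : realType) (p N : nat) : (p <= N)%N ->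
  euler_weight R p <=
  expR (\sum_(p.+1 <= r < N.+1 | prime r) r%:R^-1) * euler_weight R N.
Proof.
elim: N => [|N IH]; first by case: p => // _; rewrite big_geq // expR0 mul1r.
rewrite leq_eqVlt => /orP[/eqP ->|]; first by rewrite big_geq // expR0 mul1r.
rewrite ltnS => pN; rewrite big_nat_recr_cond //= expRD euler_weightS.
apply: (le_trans (IH pN)); case: (prime N.+1); last by rewrite expR0 !mulr1.
rewrite mulrACA ler_pMr ?mulr_gt0 ?expR_gt0 ?euler_weight_gt0 //.
by rewrite ler_pdivlMr ?mul1r ?expR_ge1Dx // ltr_wpDr.
Qed.

(** * Chebyshev's bound and the decay of the weight from [y] to [y^2] *)

Lemma prod_primes_dvd_bin (n : nat) :
  (\prod_(n.+1 <= r < n.*2.+1 | prime r) r %| 'C(n.*2, n))%N.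
Proof.
apply/unstable.Gauss_dvd_prod => [|r].
  rewrite map_id; set s := [seq r <- _ | _].
  have: pairwise (fun a b => a != b) s by rewrite -uniq_pairwise filter_uniq ?iota_uniq.
  apply: (@sub_in_pairwise _ prime) (filter_all _ _).
  move=> a b pa pb.
  by rewrite prime_coprime // dvdn_prime2.
rewrite mem_index_iota => /andP[nr r2n] pr.
have := dvdn_fact (m := r) (n := n.*2); rewrite prime_gt0 // => /(_ r2n).
(* As [r] exceeds every factor of [n!], in [(2n)! = C(2n,n) * n! * n!] it can only divide the
   binomial. *)
have nd : ~~ (r %| n`!)%N.
  rewrite fact_prod Euclid_dvd_prod // big_has_cond; apply/hasPn => i.
  rewrite mem_index_iota ltnS => /andP[i0 iN] /=; rewrite gtnNdvd //.
  exact: leq_ltn_trans nr.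
rewrite -(@bin_fact n.*2 n) -?addnn ?leq_addr // addnK addnn.
by rewrite !Euclid_dvdM // (negbTE nd) !orbF.
Qed.

Lemma bin_le_exp2 (n m : nat) : ('C(n, m) <= 2 ^ n)%N.
Proof.
case: (leqP m n) => [mn|/bin_small -> //].
rewrite -[2%N]/(1 + 1)%N Pascal (bigD1 (inord m)) //= inordK ?ltnS //.
by rewrite !exp1n !muln1 leq_addr.
Qed.

(** With [n = 2^k] and [c] primes in [(n, 2n]], [2^(kc)] is at most their product, hence at most
    [C(2n,n) <= 2^(2n)]. So [c <= 2n/k], and each reciprocal is below [1/n]. *)
Lemma sum_inv_primes_dyadic (R : realType) (k : nat) : (0 < k)%N ->
  \sum_((2 ^ k).+1 <= r < (2 ^ k.+1).+1 | prime r) (r%:R : R)^-1 <= 2 / k%:R.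
Proof.
move=> k0; set n := (2 ^ k)%N.
have n0 : (0 < n)%N by rewrite expn_gt0.
have n2 : (2 ^ k.+1 = n.*2)%N by rewrite expnS mul2n.
set c := (\sum_(n.+1 <= r < n.*2.+1 | prime r) 1)%N.
have hc : (k * c <= n.*2)%N.
  rewrite -(leq_exp2l (m := 2)) // expnM -/n.
  apply: leq_trans (bin_le_exp2 n.*2 n).
  apply: leq_trans (dvdn_leq _ (prod_primes_dvd_bin n)); last first.
    by rewrite bin_gt0 -addnn leq_addr.
  rewrite /c expn_sum; rewrite big_nat_cond [leqRHS]big_nat_cond.
  apply: leq_prod => r /andP[/andP[nr _] _].
  by rewrite expn1 ltnW.
rewrite n2; apply: (@le_trans _ _ (c%:R / n%:R)).
  rewrite /c natr_sum mulr_suml big_nat_cond [leRHS]big_nat_cond.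
  apply: ler_sum => r /andP[/andP[nr _] _].
  by rewrite mul1r lef_pV2 ?posrE ?ltr0n ?ler_nat ?(ltnW nr) // (leq_ltn_trans _ nr).
rewrite ler_pdivrMr ?ltr0n // mulrAC ler_pdivlMr ?ltr0n //.
by rewrite -!natrM ler_nat mulnC mul2n.
Qed.

(** If [2^k <= y < 2^(k+1)], then [k + 2] dyadic blocks cover [(y, y^2]]. Each contributes at most
    [2/k], and [2(k+2)/k <= 6] for [k >= 1]. *)
Lemma sum_inv_primes_square (R : realType) (y : nat) : (1 < y)%N ->
  \sum_(y.+1 <= r < (y ^ 2).+1 | prime r) (r%:R : R)^-1 <= 6%:R.
Proof.
move=> y1; set k := trunc_log 2 y.
have k0 : (0 < k)%N by rewrite trunc_log_gt0.
have /andP[ky yk] := trunc_log_bounds (isT : 1 < 2)%N (ltnW y1).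
rewrite -/k in ky yk.
pose S a b : R := \sum_(a.+1 <= r < b.+1 | prime r) (r%:R : R)^-1.
have S0 a b : 0 <= S a b by apply: sumr_ge0 => r _; rewrite invr_ge0.
have Scat a b c : (a <= b)%N -> (b <= c)%N -> S a c = S a b + S b c.
  by move=> ab bc; rewrite /S (@big_cat_nat _ _ _ b.+1).
have yk2 : (y ^ 2 <= 2 ^ (k + k.+2))%N.
  by rewrite -addSnnS expnD -mulnn leq_mul // ltnW.
have e2 a b : (a <= b)%N -> (2 ^ a <= 2 ^ b)%N by move=> ab; rewrite leq_exp2l.
have yy : (y <= y ^ 2)%N by rewrite -{1}(expn1 y) leq_exp2l.
apply: (@le_trans _ _ (S (2 ^ k)%N (2 ^ (k + k.+2))%N)).
  rewrite (Scat _ y) ?(leq_trans yy) // (Scat y (y ^ 2)%N) // -/(S y (y^2)%N).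
  by rewrite addrCA lerDl addr_ge0.
have dy m : S (2 ^ k)%N (2 ^ (k + m))%N <= m%:R * (2 / k%:R).
  elim: m => [|m IH]; first by rewrite addn0 /S big_geq // mul0r.
  rewrite (Scat _ (2 ^ (k + m))%N) ?e2 ?leq_addr ?addnS // -[m.+1]addn1 natrD mulrDl.
  apply: lerD => //; rewrite mul1r; apply: le_trans (sum_inv_primes_dyadic R _) _.
    by rewrite addn_gt0 k0.
  by rewrite ler_pM2l // lef_pV2 ?posrE ?ltr0n ?ler_nat ?leq_addr ?addn_gt0 ?k0.
apply: (le_trans (dy _)).
rewrite mulrA ler_pdivrMr ?ltr0n // -!natrM ler_nat; lia.
Qed.

Lemma euler_weight_square (R : realType) (y : nat) : (1 < y)%N ->
  expR (- 6%:R) * euler_weight R y <= euler_weight R (y ^ 2)%N.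
Proof.
move=> y1; rewrite expRN mulrC ler_pdivrMr ?expR_gt0 // mulrC.
have yy : (y <= y ^ 2)%N by rewrite -{1}(expn1 y) leq_exp2l.
apply: le_trans (euler_weight_le_expR R yy) _.
by rewrite ler_pM2r ?euler_weight_gt0 // ler_expR sum_inv_primes_square.
Qed.

Definition ln_ratio_bound (R : realType) : R := 1 - expR (- 6%:R) / 2.

Lemma ln_nat_ge0 (R : realType) (n : nat) : 0 <= ln (n%:R : R).
Proof. by case: n => [|n]; [rewrite ln0|rewrite ln_ge0 // ler1n]. Qed.

Lemma le_ln_nat (R : realType) (m n : nat) : (0 < m)%N -> (m <= n)%N ->
  ln (m%:R : R) <= ln n%:R.
Proof. by move=> m0 mn; rewrite ler_ln ?posrE ?ltr0n ?ler_nat // (leq_trans m0). Qed.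

(** The ratio of logarithms is at most 1 up to [p^2] and at most 1/2 beyond, which bounds the sum by
    [W(p) - W(p^2)/2] once [N > p^2]. *)
Lemma sum_euler_weight_ln_ratio (R : realType) (p N : nat) :
    (0 < p)%N -> (p <= N)%N ->
  \sum_(p.+1 <= q < N.+1 | prime q)
     euler_weight R q / q%:R * (ln p%:R / ln q%:R) <=
  ln_ratio_bound R * euler_weight R p.
Proof.
move=> p0 pN; have W0 x := euler_weight_gt0 R x.
have e0 : 0 < expR (- 6%:R : R) by rewrite expR_gt0.
have e1 : expR (- 6%:R : R) <= 1 by rewrite -[leRHS]expR0 ler_expR oppr_le0.
(* The value [p = 1] does occur, as [max_pdiv 1]; then [ln p = 0]. *)
have [p1|p1] := leqP p 1.
  have -> : p = 1%N by lia.
  rewrite big1 => [|q _]; last by rewrite ln1 mul0r mulr0.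
  by rewrite mulr_ge0 ?ltW // /ln_ratio_bound; lra.
have sq := euler_weight_square R p1.
have WqV0 q : 0 <= euler_weight R q / q%:R by rewrite divr_ge0 ?(ltW (W0 q)).
have low N' : (p <= N')%N ->
    \sum_(p.+1 <= q < N'.+1 | prime q) euler_weight R q / q%:R * (ln p%:R / ln q%:R)
      <= euler_weight R p - euler_weight R N'.
  move=> pN'; rewrite -sum_euler_weight // big_nat_cond [leRHS]big_nat_cond.
  apply: ler_sum => q /andP[/andP[pq _] _]; rewrite ler_piMr //.
  rewrite ler_pdivrMr ?mul1r ?le_ln_nat // ?(ltnW pq) //.
  by rewrite ln_gt0 // ltr1n (leq_trans p1) // ltnW.
have [Ny|yN] := leqP N (p ^ 2)%N.
  apply: (le_trans (low _ pN)); have := le_euler_weight R Ny.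
  have := W0 p; rewrite /ln_ratio_bound; nra.
have py : (p <= p ^ 2)%N by rewrite -{1}(expn1 p) leq_exp2l.
rewrite (@big_cat_nat _ _ _ (p ^ 2).+1) //=; last exact: ltnW.
have high : \sum_((p ^ 2).+1 <= q < N.+1 | prime q)
    euler_weight R q / q%:R * (ln p%:R / ln q%:R) <= euler_weight R (p ^ 2)%N / 2.
  apply: (@le_trans _ _ ((euler_weight R (p ^ 2)%N - euler_weight R N) / 2)).
    rewrite -sum_euler_weight ?(ltnW yN) // mulr_suml.
    rewrite big_nat_cond [leRHS]big_nat_cond.
    apply: ler_sum => q /andP[/andP[pq _] _]; rewrite ler_wpM2l //.
    have q1 : (1 < q)%N by rewrite (leq_trans p1) // (leq_trans py) // ltnW.
    rewrite ler_pdivrMr ?ln_gt0 ?ltr1n // mulrC ler_pdivlMr // mulr_natr -lnXn ?ltr0n //.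
    by rewrite -natrX le_ln_nat ?expn_gt0 ?p0 // ltnW.
  by rewrite ler_pM2r ?invr_gt0 // gerBl ltW.
have := low _ py; move: high sq; rewrite /ln_ratio_bound; lra.
Qed.

(** * Smooth numbers and the upper bound for [W(x) log x] *)

Lemma max_pdiv_le1_or_prime (n : nat) : (0 < n)%N -> n = 1%N \/ prime (max_pdiv n).
Proof. by case: n => [|[|n]] // _; [left|right; exact: max_pdiv_prime]. Qed.

Lemma sum_nat_dvd (R : realType) (F : nat -> R) (p N : nat) : (0 < p)%N ->
  \sum_(1 <= n < N.+1 | (p %| n)%N) F n = \sum_(1 <= m < (N %/ p).+1) F (p * m)%N.
Proof.
move=> p0; elim: N => [|N IH]; first by rewrite div0n !big_geq.
rewrite big_nat_recr_cond //= IH divnS //.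
case pN: (p %| N.+1)%N; last by rewrite addr0 add0n.
rewrite [RHS]big_nat_recr //=; congr (_ + F _).
by rewrite -[LHS](divnK pN) mulnC divnS // pN.
Qed.

(* Euler's product bound: the y-smooth part of the harmonic sum is at most
   prod_(p <= y) (1 - 1/p)^-1; the factor 2y/(y+1) is the telescoped form of
   prod_(2 <= n <= y) (1 - 1/n^2)^-1, which turns (1 - 1/p)^-1 into 1 + 1/p. *)
Lemma smooth_harmonic_le (R : realType) (y N : nat) : (0 < y)%N ->
  \sum_(1 <= n < N.+1 | (max_pdiv n <= y)%N) (n%:R : R)^-1 <=
  2 * y%:R / y.+1%:R / euler_weight R y.
Proof.
case: y => // y _; elim: y => [|y IH].
  rewrite euler_weight1 invr1 !mulr1 divff ?pnatr_eq0 //.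
  case: N => [|N]; first by rewrite big_geq.
  rewrite big_ltn_cond //= big_nat_cond big_pred0 ?invr1 ?addr0 // => n.
  apply/negP => /andP[/andP[n1 _]] /=.
  by rewrite leqNgt prime_gt1 ?max_pdiv_prime.
have W0 x := euler_weight_gt0 R x.
have inv0 (n : nat) : 0 <= (n%:R : R)^-1 by rewrite invr_ge0.
set f := (X in X <= _) in IH.
(* For composite [y+2] the set of smooth numbers does not change, while [2y/(y+1)] grows with
   [y]. *)
have [pr|npr] := boolP (prime y.+2); last first.
  rewrite euler_weightS (negbTE npr) mulr1; apply: le_trans.
    apply: le_trans IH; rewrite le_eqVlt; apply/orP; left; apply/eqP.
    rewrite /f big_nat_cond [RHS]big_nat_cond; apply: eq_bigl => n.
    apply: andb_id2l => /andP[n0 _]; rewrite leq_eqVlt ltnS orb_idl // => /eqP ny.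
    by have [n1|] := max_pdiv_le1_or_prime n0; [rewrite n1 in ny | rewrite ny (negbTE npr)].
  rewrite ler_pM2r ?invr_gt0 // ler_pdivrMr ?ltr0n // mulrAC ler_pdivlMr ?ltr0n //.
  by rewrite -!natrM ler_nat; lia.
set g := (X in X <= _).
(* Split by divisibility by the prime [y+2]: non-multiples are already counted in [f], and dividing
   a multiple by [y+2] leaves a term of [g]. *)
have gf : g <= f + g / y.+2%:R.
  rewrite {1}/g (bigID (fun n => y.+2 %| n)%N) /= addrC; apply: lerD.
    rewrite /f big_nat_cond [leRHS]big_nat_cond big_mkcond [leRHS]big_mkcond /=.
    apply: ler_sum => n _; case: ifP => [/andP[/andP[n0 nN] /andP[ny dn]]|_]; last by case: ifP.
    rewrite n0 nN /= -ltnS ltn_neqAle ny andbT.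
    by case: eqP => // my; rewrite -my max_pdiv_dvd in dn.
  rewrite (eq_bigl (fun n => (y.+2 %| n) && (max_pdiv n <= y.+2))%N); last first.
    by move=> n; rewrite andbC.
  rewrite big_mkcondr /= sum_nat_dvd // /g mulr_suml.
  rewrite [leRHS](@big_cat_nat _ _ _ (N %/ y.+2).+1) //= ?ltnS ?leq_div //.
  rewrite -[leLHS]addr0 lerD //; last by apply: sumr_ge0 => n _; rewrite mulr_ge0.
  rewrite big_nat_cond [leRHS]big_nat_cond big_mkcond [leRHS]big_mkcond /=.
  apply: ler_sum => n _; rewrite andbT; case: ifP => //= /andP[n0 _].
  have [sm|] := leqP (max_pdiv (y.+2 * n)) y.+2; last by case: ifP => // _ _; rewrite mulr_ge0.
  suff -> : (max_pdiv n <= y.+2)%N by rewrite natrM invfM mulrC.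
  apply: leq_trans sm; case: (ltnP 1 n) => n1; last by rewrite (_ : n = 1%N) //; lia.
  apply: max_pdiv_max; rewrite mem_primes max_pdiv_prime // muln_gt0 n0 /=.
  by rewrite dvdn_mull // max_pdiv_dvd.
rewrite euler_weightS pr.
have : g * (y.+1%:R / y.+2%:R) <= f.
  have : g * (y.+1%:R / y.+2%:R) = g - g / y.+2%:R.
    rewrite -[y.+2%:R]natr1; have := ltr0Sn R y; move: (y.+1%:R) => a a0.
    by field; rewrite gt_eqF // addr_gt0.
  by move=> ->; rewrite lerBlDr.
move/le_trans/(_ IH); rewrite -ler_pdivlMr ?divr_gt0 ?ltr0n // => /le_trans; apply.
(* With [q = y+2] this is [(1 - 1/q)^-1 = (1 + 1/q) (1 - 1/q^2)^-1]. *)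
rewrite le_eqVlt; apply/orP; left; apply/eqP.
have Wn := lt0r_neq0 (W0 y.+1).
rewrite -[y.+3%:R]natr1 -[y.+2%:R]natr1; have := ltr0Sn R y.
move: (y.+1%:R) => a a0.
by field; rewrite Wn !gt_eqF // !addr_gt0.
Qed.

(** All [n <= N] are [N]-smooth, so [ln (N+1) <= 1 + 1/2 + ... + 1/N] is at most the smooth sum
    bounded above. *)
Lemma euler_weight_ln_le (R : realType) (N : nat) : (0 < N)%N ->
  euler_weight R N * ln N%:R <= 2.
Proof.
move=> N0; have W0 := euler_weight_gt0 R N.
have harm M : ln (M.+1%:R : R) <= \sum_(1 <= n < M.+1) (n%:R : R)^-1.
  elim: M => [|M IH]; first by rewrite ln1 big_geq.
  rewrite big_nat_recr //= (_ : M.+2%:R = M.+1%:R * (1 + M.+1%:R^-1)); last first.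
    by rewrite mulrDr mulr1 divff ?pnatr_eq0 // natr1.
  rewrite lnM ?posrE ?ltr0n ?ltr_wpDr // lerD // le_ln1Dx //.
  by rewrite (@lt_le_trans _ _ 0) ?ltrN10.
rewrite mulrC -ler_pdivlMr //.
apply: (le_trans (le_ln_nat R N0 (leqnSn N))); apply: (le_trans (harm N)).
rewrite big_nat_cond (eq_bigl (fun n => (1 <= n < N.+1)%N && (max_pdiv n <= N)%N)).
  rewrite -big_nat_cond; apply: (le_trans (smooth_harmonic_le R N N0)).
  rewrite ler_pM2r ?invr_gt0 // ler_pdivrMr ?ltr0n // ler_pM2l //.
  by rewrite ler_nat.
move=> n /=; apply: andb_id2l => /andP[n0 nN].
by rewrite (leq_trans (max_pdiv_leq n0)).
Qed.

(** Lets the mass lost by truncating at [N] be made as small as needed. *)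
Lemma euler_weight_small (R : realType) (e : R) (N0 : nat) : 0 < e ->
  exists2 N, (N0 <= N)%N & euler_weight R N < e.
Proof.
move=> e0; pose N := maxn N0 (Num.truncn (expR (2 / e))).+1.
have N1 : (0 < N)%N by rewrite leq_max orbT.
have lN : 2 / e < ln (N%:R : R).
  rewrite -ltr_expR lnK ?posrE ?ltr0n //.
  apply: lt_le_trans (truncnS_gt _) _; by rewrite ler_nat leq_max leqnn orbT.
exists N; first by rewrite leq_max leqnn.
have l0 : 0 < ln (N%:R : R) by apply: lt_trans lN; rewrite divr_gt0.
have := euler_weight_ln_le R N1; rewrite -ler_pdivlMr // => /le_lt_trans; apply.
by rewrite ltr_pdivrMr // mulrC -ltr_pdivrMr.
Qed.

(** * Levels of squarefree integers *)

Definition squarefree_level (k n : nat) : bool :=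
  [&& (0 < n)%N, (\prod_(p <- primes n) p == n)%N & size (primes n) == k].

Lemma primesM_prime_gt (n q : nat) : (0 < n)%N -> prime q -> (max_pdiv n < q)%N ->
  primes (n * q) = rcons (primes n) q.
Proof.
move=> n0 pq nq; apply: (irr_sorted_eq ltn_trans ltnn).
- exact: sorted_primes.
- rewrite /max_pdiv in nq; have := sorted_primes n.
  by case: (primes n) nq => //= x s sq; rewrite rcons_path => -> /=.
- by move=> p; rewrite (primesM _ n0 (prime_gt0 pq)) (primes_prime pq) mem_rcons !inE orbC.
Qed.

Lemma max_pdivM_prime_gt (n q : nat) : (0 < n)%N -> prime q -> (max_pdiv n < q)%N ->
  max_pdiv (n * q) = q.
Proof. by move=> n0 pq nq; rewrite /max_pdiv primesM_prime_gt // last_rcons. Qed.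

Lemma squarefree_levelM (k n q : nat) :
    squarefree_level k n -> prime q -> (max_pdiv n < q)%N ->
  squarefree_level k.+1 (n * q).
Proof.
move=> /and3P[n0 /eqP nn /eqP sn] pq nq; apply/and3P; split.
- by rewrite muln_gt0 n0 prime_gt0.
- by rewrite primesM_prime_gt // big_rcons /= nn mulnC.
- by rewrite primesM_prime_gt // size_rcons sn.
Qed.

(** Divisibility gives inclusion of the sets of primes, and equal size makes them equal. This is the
    primitivity of a level. *)
Lemma squarefree_level_dvd (k m n : nat) :
  squarefree_level k m -> squarefree_level k n -> (m %| n)%N -> m = n.
Proof.
move=> /and3P[m0 /eqP mm /eqP sm] /and3P[n0 /eqP nn /eqP sn] mn.
rewrite -mm -nn; congr (\prod_(p <- _) p)%N.
apply: (irr_sorted_eq ltn_trans ltnn); rewrite ?sorted_primes //.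
have sub : {subset primes m <= primes n}.
  move=> p; rewrite !mem_primes n0 => /and3P[-> _ /= pm]; exact: dvdn_trans mn.
by apply: (uniq_min_size (primes_uniq m) sub _).2; rewrite sm sn.
Qed.

Definition level_mass (R : realType) (B : seq nat) : R :=
  \sum_(n <- B) euler_weight R (max_pdiv n) / n%:R.

(** The mean of [X] from the overview, not divided by the mass; [n = 1] contributes 0, since
    [0 / 0 = 0]. *)
Definition level_moment (R : realType) (B : seq nat) : R :=
  \sum_(n <- B) euler_weight R (max_pdiv n) / n%:R * (ln n%:R / ln (max_pdiv n)%:R).

Definition extend_level (N : nat) (B : seq nat) : seq nat :=
  [seq (n * q)%N | n <- B, q <- [seq q <- index_iota (max_pdiv n).+1 N.+1 | prime q]].

Lemma extend_level_sub (k N : nat) (B : seq nat) :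
  all (squarefree_level k) B -> all (squarefree_level k.+1) (extend_level N B).
Proof.
move=> /allP BP; apply/allP => _ /allpairsPdep[n [q [nB + ->]]].
rewrite mem_filter mem_index_iota => /andP[pq /andP[nq _]].
exact: squarefree_levelM (BP _ nB) _ _.
Qed.

(** The factor [q] is recovered from [n * q] as its largest prime factor. *)
Lemma extend_level_uniq (N : nat) (B : seq nat) :
  all (leq 1) B -> uniq B -> uniq (extend_level N B).
Proof.
move=> /allP B0 uB; apply: allpairs_uniq_dep => // [n _|].
  by rewrite filter_uniq // iota_uniq.
move=> _ _ /allpairsPdep[n [q [nB + ->]]] /allpairsPdep[n' [q' [nB' + ->]]] /=.
rewrite !mem_filter !mem_index_iota => /andP[pq /andP[nq _]] /andP[pq' /andP[nq' _]] e.
have qq' : q = q'.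
  by rewrite -(max_pdivM_prime_gt (B0 _ nB) pq nq) e max_pdivM_prime_gt // B0.
move: e; rewrite qq' => /eqP; rewrite eqn_pmul2r ?prime_gt0 // => /eqP -> //.
Qed.

Lemma sum_extend_level (R : realType) (N : nat) (B : seq nat) (F : nat -> nat -> R) :
    all (leq 1) B ->
  \sum_(n <- extend_level N B) F n (max_pdiv n) =
  \sum_(n <- B) \sum_((max_pdiv n).+1 <= q < N.+1 | prime q) F (n * q)%N q.
Proof.
move=> /allP B0; rewrite big_allpairs_dep; apply: eq_big_seq => n nB.
rewrite big_filter big_nat_cond [RHS]big_nat_cond.
apply: eq_bigr => q /andP[/andP[nq _] pq].
by rewrite max_pdivM_prime_gt // B0.
Qed.

(** The loss is what the telescoping sum of each [n] leaves beyond [N]. *)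
Lemma level_mass_extend (R : realType) (N : nat) (B : seq nat) :
    all (leq 1) B -> all (fun n => max_pdiv n <= N)%N B ->
  level_mass R (extend_level N B) =
  level_mass R B - euler_weight R N * \sum_(n <- B) n%:R^-1.
Proof.
move=> B0 /allP BN.
rewrite /level_mass (sum_extend_level N (fun n p => euler_weight R p / n%:R) B0).
rewrite mulr_sumr -sumrB; apply: eq_big_seq => n nB.
rewrite -mulrBl -sum_euler_weight ?BN // mulr_suml; apply: eq_bigr => q _.
by rewrite natrM invfM mulrA mulrAC.
Qed.

(** Since [log n = X(n) log P(n)], [X(n q) = 1 + X(n) log P(n) / log q]: the 1 yields the mass, and
    the other term contracts by [ln_ratio_bound]. *)
Lemma level_moment_extend (R : realType) (N : nat) (B : seq nat) :
    all (leq 1) B -> all (fun n => max_pdiv n <= N)%N B ->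
  level_moment R (extend_level N B) <=
  level_mass R B + ln_ratio_bound R * level_moment R B.
Proof.
move=> B0 BN.
pose F n p : R := euler_weight R p / n%:R * (ln n%:R / ln p%:R).
rewrite /level_moment (sum_extend_level N F B0) /level_mass mulr_sumr -big_split /=.
rewrite big_seq [leRHS]big_seq; apply: ler_sum => n nB.
have n0 := allP B0 _ nB; have nN := allP BN _ nB.
have p0 := max_pdiv_gt0 n.
set p := max_pdiv n in nN p0 *.
have n0' : 0 < (n%:R : R) by rewrite ltr0n.
set X : R := ln n%:R / ln p%:R.
have lnX : ln (n%:R : R) = X * ln p%:R.
  rewrite /X; have [p1|n1] := max_pdiv_le1_or_prime n0.
    by rewrite p1 ln1 mul0r mul0r.
  by rewrite divfK // gt_eqF // ln_gt0 // ltr1n prime_gt1.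
have X0 : 0 <= X by rewrite divr_ge0 ?ln_nat_ge0.
have -> : \sum_(p.+1 <= q < N.+1 | prime q) F (n * q)%N q =
  (\sum_(p.+1 <= q < N.+1 | prime q) euler_weight R q / q%:R) / n%:R +
  (\sum_(p.+1 <= q < N.+1 | prime q)
     euler_weight R q / q%:R * (ln p%:R / ln q%:R)) * (X / n%:R).
  rewrite !mulr_suml -big_split; apply: eq_bigr => q pq /=.
  have q0 : 0 < (q%:R : R) by rewrite ltr0n prime_gt0.
  have lq0 : 0 < ln (q%:R : R) by rewrite ln_gt0 // ltr1n prime_gt1.
  rewrite /F natrM lnM ?posrE // lnX.
  by field; rewrite !gt_eqF.
apply: lerD.
  rewrite ler_pM2r ?invr_gt0 // sum_euler_weight // gerBl ltW //.
  exact: euler_weight_gt0.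
rewrite [leRHS](_ : _ = ln_ratio_bound R * euler_weight R p * (X / n%:R)).
  by apply: ler_wpM2r; [exact: divr_ge0 | exact: sum_euler_weight_ln_ratio].
by rewrite /X; ring.
Qed.

Lemma squarefree_level_gt0 (k : nat) (B : seq nat) :
  all (squarefree_level k) B -> all (leq 1) B.
Proof. by apply: sub_all => n /and3P[]. Qed.

(** The moment bound is the fixed point of [t -> 1 + u t]. Keeping the mass strictly above 1/2
    leaves room for the next truncation. *)
Lemma exists_level (R : realType) (k : nat) :
  exists B : seq nat,
    [/\ uniq B, all (squarefree_level k) B,
        2^-1 < level_mass R B, level_mass R B <= 1 &
        level_moment R B <= (1 - ln_ratio_bound R)^-1].
Proof.
have e0 : 0 < expR (- 6%:R : R) by rewrite expR_gt0.
have e1 : expR (- 6%:R : R) <= 1 by rewrite -[leRHS]expR0 ler_expR oppr_le0.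
have u1 : 0 < 1 - ln_ratio_bound R by rewrite /ln_ratio_bound; lra.
have u0 : 0 <= ln_ratio_bound R by rewrite /ln_ratio_bound; lra.
elim: k => [|k [B [uB lB M2 M1 Y]]].
  exists [:: 1%N]; split=> //.
  - by rewrite /= /squarefree_level /= big_nil.
  - by rewrite /level_mass big_seq1 euler_weight1; lra.
  - by rewrite /level_mass big_seq1 euler_weight1; lra.
  - by rewrite /level_moment big_seq1 ln1 mul0r mulr0 invr_ge0 ltW.
have B0 := squarefree_level_gt0 lB.
pose S : R := \sum_(n <- B) n%:R^-1.
have S0 : 0 <= S by apply: sumr_ge0 => n _; rewrite invr_ge0.
have S1 : 0 < 1 + S by rewrite ltr_wpDr.
(* Truncation costs [W(N) S < W(N) (1 + S)], to be kept below the excess over 1/2. *)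
have d0 : 0 < (level_mass R B - 2^-1) / (1 + S) by rewrite divr_gt0 ?subr_gt0.
have [N BN WN] := euler_weight_small (\max_(n <- B) n) d0.
have {}BN : all (fun n => max_pdiv n <= N)%N B.
  apply/allP => n nB; apply: leq_trans BN.
  apply: leq_trans (max_pdiv_leq (allP B0 _ nB)) _.
  by rewrite (big_rem n nB) leq_maxl.
have W0 := euler_weight_gt0 R N.
exists (extend_level N B); split.
- exact: extend_level_uniq.
- exact: extend_level_sub.
- rewrite level_mass_extend // -/S; move: WN; rewrite ltr_pdivlMr //.
  by lra.
- by rewrite level_mass_extend // -/S (le_trans _ M1) // gerBl mulr_ge0 // ltW.
- apply: (le_trans (level_moment_extend _ B0 BN)).
  apply: (@le_trans _ _ (1 + ln_ratio_bound R * (1 - ln_ratio_bound R)^-1)).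
    by rewrite lerD // ler_wpM2l.
  by rewrite le_eqVlt; apply/orP; left; apply/eqP; field; rewrite gt_eqF.
Qed.

(** * Comparison of the two sums *)

Lemma omega_term_ge0 (R : realType) (n : nat) :
  0 <= (omega n)%:R / (n%:R * ln (n%:R : R)).
Proof. by rewrite divr_ge0 // mulr_ge0 // ln_nat_ge0. Qed.

(** By [W(P(n)) log P(n) <= 2], the term is at least [(k+1)/2] times the weight of [n] times [1/X].
    A tangent line then makes the bound linear in [X], so that summing it involves only the mass and
    the moment. *)
Lemma omega_term_ge (R : realType) (k n : nat) (a : R) :
    squarefree_level k.+1 n ->
  k.+1%:R / 2 * (2 * a * (euler_weight R (max_pdiv n) / n%:R) -
    a ^+ 2 * (euler_weight R (max_pdiv n) / n%:R * (ln n%:R / ln (max_pdiv n)%:R)))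
  <= (omega n)%:R / (n%:R * ln (n%:R : R)).
Proof.
move=> /and3P[n0 _ /eqP sn]; rewrite /omega sn.
have n1 : (1 < n)%N by case: n n0 sn => [|[]].
have pp := max_pdiv_prime n1; have p1 := prime_gt1 pp.
have Wl := euler_weight_ln_le R (max_pdiv_gt0 n).
have W0 := euler_weight_gt0 R (max_pdiv n).
have lp : 0 < ln ((max_pdiv n)%:R : R) by rewrite ln_gt0 // ltr1n.
have L0 : 0 < ln (n%:R : R) by rewrite ln_gt0 // ltr1n.
have x0 : 0 < (n%:R : R) by rewrite ltr0n.
set W := euler_weight R _ in W0 Wl *.
set l := ln (max_pdiv n)%:R in Wl lp *; set L := ln n%:R in L0 *.
set x : R := n%:R in x0 *; have c0 : 0 <= (k.+1%:R : R) by [].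
set c := k.+1%:R in c0 *.
(* the tangent to [1/X] at [1/a], where [X = L / l] *)
have tangent : 2 * a - a ^+ 2 * (L / l) <= l / L.
  rewrite -subr_ge0.
  have -> : l / L - (2 * a - a ^+ 2 * (L / l)) = (l - a * L) ^+ 2 / (l * L).
    by field; rewrite !gt_eqF.
  by rewrite divr_ge0 ?sqr_ge0 // mulr_ge0 // ltW.
have -> : c / 2 * (2 * a * (W / x) - a ^+ 2 * (W / x * (L / l))) =
    c / 2 * (W / x) * (2 * a - a ^+ 2 * (L / l)) by ring.
apply: (@le_trans _ _ (c / 2 * (W / x) * (l / L))).
  by rewrite ler_wpM2l // mulr_ge0 // divr_ge0 // ltW.
have -> : c / 2 * (W / x) * (l / L) = c / (x * L) * (W * l / 2).
  by field; rewrite !gt_eqF.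
by apply: ler_piMr; [rewrite divr_ge0 // mulr_ge0 // ltW | rewrite ler_pdivrMr // mul1r].
Qed.

Lemma exists_large_level (R : realType) (C : R) :
  exists (k : nat) (B : seq nat),
    [/\ uniq B, all (squarefree_level k.+1) B &
        C < \sum_(n <- B) (omega n)%:R / (n%:R * ln (n%:R : R))].
Proof.
set v := 1 - ln_ratio_bound R.
have v0 : 0 < v.
  by rewrite /v /ln_ratio_bound opprB addrC subrK divr_gt0 ?expR_gt0.
(* Chosen so that [(k+1) v / 8 > |C|]. *)
pose k := Num.truncn (`|C| * 8 / v).
have [B [uB lB M2 M1 Y]] := exists_level R k.+1.
(* With mass 1/2 and moment [1/v], the lower bound [a - a^2/v] is largest at [a = v/2], with value
   [v/4]. *)
exists k, B; split => //; pose a := v / 2.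
apply: (@lt_le_trans _ _ (k.+1%:R / 2 * (2 * a * level_mass R B - a ^+ 2 * level_moment R B))).
  have kC : `|C| * 8 / v < k.+1%:R by exact: truncnS_gt.
  rewrite ltr_pdivrMr // in kC.
  have aY : a ^+ 2 * level_moment R B <= v / 4.
    apply: (@le_trans _ _ (a ^+ 2 * v^-1)); first by rewrite ler_wpM2l ?sqr_ge0.
    by rewrite le_eqVlt; apply/orP; left; apply/eqP; rewrite /a; field; rewrite gt_eqF.
  have vM : v / 2 < 2 * a * level_mass R B.
    have -> : 2 * a = v by rewrite /a; field.
    by rewrite ltr_pM2l.
  have : C <= `|C| by rewrite ler_norm.
  have k0 : 0 < (k.+1%:R : R) by [].
  move: (2 * a * _) (a ^+ 2 * _) aY vM => x y aY vM CC.
  apply: (@le_lt_trans _ _ (k.+1%:R / 2 * (v / 4))); first by lra.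
  by rewrite ltr_pM2l ?divr_gt0 //; lra.
rewrite /level_mass /level_moment !mulr_sumr -sumrB mulr_sumr.
rewrite big_seq [leRHS]big_seq; apply: ler_sum => n nB.
exact: omega_term_ge (allP lB _ nB).
Qed.

(** * Convergence of the sum over the primes *)

Lemma sum_inv_prime_ln_square (R : realType) (y : nat) : (1 < y)%N ->
  \sum_(y.+1 <= p < (y ^ 2).+1 | prime p) (p%:R * ln (p%:R : R))^-1 <= 6%:R / ln y%:R.
Proof.
move=> y1; have ly : 0 < ln (y%:R : R) by rewrite ln_gt0 // ltr1n.
apply: (@le_trans _ _ (\sum_(y.+1 <= p < (y ^ 2).+1 | prime p) p%:R^-1 / ln (y%:R : R))).
  rewrite big_nat_cond [leRHS]big_nat_cond; apply: ler_sum => p /andP[/andP[yp _] _].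
  rewrite invfM ler_wpM2l ?invr_ge0 // lef_pV2 ?posrE ?le_ln_nat // ?(ltnW yp) 1?ltnW //.
  by rewrite ln_gt0 // ltr1n (leq_trans y1) // ltnW.
by rewrite -mulr_suml ler_pM2r ?invr_gt0 // sum_inv_primes_square.
Qed.

(** Cut the primes at [2^(2^i)]: by repeated squaring, block [i] contributes at most
    [6 / (2^i ln 2)], a geometric series with sum [12 / ln 2]. *)
Lemma sum_inv_prime_ln_bounded (R : realType) :
  exists C : R, forall N,
    \sum_(0 <= p < N | prime p) (p%:R * ln (p%:R : R))^-1 <= C.
Proof.
pose t p : R := (p%:R * ln (p%:R : R))^-1.
have t0 p : 0 <= t p by rewrite invr_ge0 mulr_ge0 // ln_nat_ge0.
pose S N := \sum_(0 <= p < N | prime p) t p.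
have Smono M N : (M <= N)%N -> S M <= S N.
  by move=> MN; rewrite /S (@big_cat_nat _ _ _ M _ _ _ _ (leq0n M) MN) /= lerDl sumr_ge0.
have l2 : 0 < ln (2 : R) by rewrite ln_gt0 // ltr1n.
have Sdbl i : S (2 ^ (2 ^ i)).+1 <= S 3 + 12%:R / ln 2 * (1 - 2^-1 ^+ i).
  elim: i => [|i IH]; first by rewrite expr0 subrr mulr0 addr0.
  have y1 : (1 < 2 ^ (2 ^ i))%N by rewrite -{1}(expn0 2) ltn_exp2l // expn_gt0.
  have := sum_inv_prime_ln_square R y1; rewrite -expnM -expnSr => sq.
  rewrite {1}/S (@big_cat_nat _ _ _ (2 ^ 2 ^ i).+1) //=; last first.
    by rewrite ltnS !leq_exp2l.
  apply: (le_trans (lerD IH sq)).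
  rewrite natrX lnXn // -[_ *+ (2 ^ i)]mulr_natr natrX exprS.
  have -> : 6%:R / (ln 2 * 2 ^+ i) = 12%:R / ln 2 * (2^-1 * 2^-1 ^+ i) :> R.
    by rewrite exprVn; field; rewrite expf_neq0 //= gt_eqF.
  by rewrite -addrA -mulrDr; set z := (2^-1 : R) ^+ i; rewrite (_ : 1 - z + 2^-1 * z = 1 - 2^-1 * z) //; field.
exists (S 3 + 12%:R / ln 2) => N; rewrite -/(S N).
apply: le_trans (Smono N (2 ^ 2 ^ N).+1 _) _.
  by apply/leqW/ltnW/(ltn_trans (ltn_expl N (isT : 1 < 2)%N)); rewrite ltn_expl.
by apply: le_trans (Sdbl N) _; rewrite lerD2l ler_piMr ?divr_ge0 ?ltW //.
Qed.

Lemma omega_sum_prime (R : realType) :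
  omega_sum R prime_set =
  \esum_(p in prime_set) ((p%:R * ln (p%:R : R))^-1)%:E.
Proof.
by apply: eq_esum => p pp; rewrite /omega primes_prime // div1r.
Qed.

Lemma omega_sum_prime_bounded (R : realType) :
  exists C : R, (omega_sum R prime_set <= C%:E)%E.
Proof.
have [C hC] := sum_inv_prime_ln_bounded R; exists C.
rewrite omega_sum_prime -nneseries_esum; last first.
  by move=> n _; rewrite lee_fin invr_ge0 mulr_ge0 // ln_nat_ge0.
apply: lime_le.
  by apply: is_cvg_nneseries => n _ _; rewrite lee_fin invr_ge0 mulr_ge0 // ln_nat_ge0.
by apply: nearW => N; rewrite sumEFin lee_fin.
Qed.

Theorem proposition2 (R : realType) :
  exists A : set nat,
    [/\ positive_terms A,
        primitive_seq A,
        A <> [set 1%N] &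
        (omega_sum R prime_set < omega_sum R A)%E /\
        omega_sum R prime_set =
          \esum_(p in prime_set) ((p%:R * ln (p%:R : R))^-1)%:E].
Proof.
have [C hC] := omega_sum_prime_bounded R.
have [k [B [uB /allP lB CB]]] := exists_large_level C.
(* A finite part of one level already exceeds the bound [C] on the sum over the primes. *)
exists [set` B]; split.
- by move=> n /lB /and3P[].
- move=> m n /lB lm /lB ln mn; apply/negP => /(squarefree_level_dvd lm ln).
  exact: mn.
(* The level index [k.+1] is positive, whereas 1 has no prime factor. *)
- by move=> B1; have /lB /and3P[] : [set` B] 1%N by rewrite B1.
- split; last exact: omega_sum_prime.
  apply: (le_lt_trans hC); rewrite /omega_sum esum_fset.
  - by rewrite -fsbig_seq // sumEFin lte_fin.
  - exact: finite_seq.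
  - by move=> n _; rewrite lee_fin omega_term_ge0.
Qed.
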